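(* Let $X$ be a reflexive Banach space, $Y$ a Banach space, $K\colon X\to Y$ a bounded linear operator, $p>1$, and $\mathcal{S}(x,y)=\frac1p\|Kx-y\|_Y^p$, where $\|\cdot\|_Y^p$ is differentiable. Let $\mathcal{R}\colon X\to[0,\infty)$ and $\phi\colon X\to[0,\infty)$ be such that conditions (C1)–(C6) listed in the context hold. Assume that $\mathcal{S}$ (in its first argument) and $\mathcal{R}$ are differentiable with weakly (sequentially) continuous derivatives $\mathcal{S}'$ and $\mathcal{R}'$, and that $$\mathcal{R}(x)+\langle\mathcal{R}'(x),u-x\rangle\le\mathcal{R}(u)+\phi(u)\qquad\text{for all }x,u\in X.$$ Let $y\in Y$ be such that $Ku=y$ for some $u\in X$. Let $y_k\in Y$ with $\|y_k-y\|_Y\le\delta_k$, and let $\alpha=\alpha(\delta)$ be such that $\alpha_k=\alpha(\delta_k)$ satisfies $\lim_k\alpha_k=\lim_k\delta_k^p/\alpha_k=0$. Let $x_k\in X$ be such that $z_k=\mathcal{S}'(x_k,y_k)+\alpha_k\mathcal{R}'(x_k)$ satisfies $\lim_k\|z_k\|/\alpha_k=0$ and $\langle z_k,x_k\rangle\le0$, and let $x_+$ be a weak cluster point of $(x_k)_k$. Then $$-\mathcal{R}'(x_+)\in\ker(K)^\perp=\{q\in X^*:\langle q,x_0\rangle=0\text{ for all }x_0\in\ker(K)\}.$$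
   Context: $X^*$ is the dual of $X$ and $\langle\cdot,\cdot\rangle$ the dual pairing. $\mathcal{R}'(x)\in X^*$ is the derivative of $\mathcal{R}$ at $x$, and $\mathcal{S}'(x,y)\in X^*$ is the derivative of $\mathcal{S}$ with respect to its first argument. Weak cluster points of a sequence are the weak limits of its weakly convergent subsequences. Relative subgradients: for $F\colon X\to\mathbb{R}$ and $\psi\colon X\to[0,\infty)$, the set $\partial_\psi F(x)$ consists of all $r\in X^*$ with $F(x)+\langle r,u-x\rangle\le F(u)+\psi(u)$ for all $u\in X$. $F$ is relatively sub-differentiable with bound $\psi$ if $\partial_\psi F(x)\ne\emptyset$ for all $x\in X$. Conditions, with $\mathcal{T}_{\alpha,y}(x)=\mathcal{S}(x,y)+\alpha\mathcal{R}(x)$ and $\mathcal{D}(y,y')=\|y-y'\|_Y$: (C1) $X$ is a reflexive Banach space and $Y$ is a metric space with metric $\mathcal{D}$. (C2) $\mathcal{R}$ is weakly sequentially lower semi-continuous. (C3) $\mathcal{R}$ is relatively sub-differentiable with bound $\phi$. (C4) $\mathcal{S}$ is weakly sequentially lower semi-continuous, convex in its first argument and continuous in its second argument. (C5) There exists $C>0$ such that $\mathcal{S}(z,y)\le C\big(\mathcal{S}(z,y')+\mathcal{D}(y,y')^p\big)$ for all $z\in X$ and $y,y'\in Y$. (C6) For all $\alpha>0$ and $y\in Y$ the functional $\mathcal{T}_{\alpha,y}$ is coercive, i.e. $\mathcal{T}_{\alpha,y}(x)\to\infty$ as $\|x\|\to\infty$. *)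

(* Defs.v *)
From HB Require Import structures.
From mathcomp Require Import all_boot all_order all_algebra.
From mathcomp Require Import all_classical all_reals all_analysis.

Set Implicit Arguments.
Unset Strict Implicit.
Unset Printing Implicit Defensive.

Import Order.TTheory GRing.Theory Num.Theory.
Import numFieldTopology.Exports numFieldNormedType.Exports.

Local Open Scope classical_set_scope.
Local Open Scope ring_scope.

Section DualSpace.
Context {R : realType} {V : normedModType R}.

Definition dual_pred : {pred V -> R^o} :=
  [pred f | `[< linear f /\ continuous f >]].

Lemma dual_submod_closed : submod_closed dual_pred.
Proof.
split.
  apply/asboolP; split=> [a u v|]; first by rewrite scaler0 addr0.
  exact: cst_continuous.
move=> a f g /asboolP[lf cf] /asboolP[lg cg]; apply/asboolP; split=> [b u v|x].
  rewrite -![(a *: f + g) _]/(a *: f _ + g _) lf lg !scalerDr !scalerA.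
  by rewrite (mulrC a b) -!addrA; congr (_ + _); rewrite addrCA.
by apply: continuousD; [apply: continuousZr; exact: cf|exact: cg].
Qed.

HB.instance Definition _ :=
  GRing.isSubmodClosed.Build R (V -> R^o) dual_pred dual_submod_closed.

End DualSpace.

Record dual (R : realType) (V : normedModType R) := Dual {
  dual_val :> V -> R^o ;
  dual_valP : dual_val \in dual_pred
}.

Section DualNorm.
Context {R : realType} {V : normedModType R}.
Implicit Types (f g : dual V).

HB.instance Definition _ := [isSub for @dual_val R V].
HB.instance Definition _ := [Choice of dual V by <:].
HB.instance Definition _ := [SubChoice_isSubLmodule of dual V by <:].

Lemma dual_linear f : linear f.
Proof. by have /asboolP[] := dual_valP f. Qed.

Lemma dual_continuous f : continuous f.
Proof. by have /asboolP[] := dual_valP f. Qed.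

HB.instance Definition _ f :=
  GRing.isLinear.Build R V R^o _ (dual_val f) (dual_linear f).

Definition dual_norm f : R := sup [set `|f x| | x in [set x | `|x| <= 1]].

Let S f := [set `|f x| | x in [set x | `|x| <= 1]].

Lemma dual_norm_has_sup f : has_sup (S f).
Proof.
split; first by exists `|f 0|, 0 => //=; rewrite normr0.
have : bounded_near f (nbhs (0 : V)).
  by apply/linear_bounded_continuous; exact: dual_continuous.
move=> /bounded_funP/(_ 1)[M fM].
by exists M => _ [x /= x1 <-]; exact: fM.
Qed.

Lemma dual_norm_ge0 f : 0 <= dual_norm f.
Proof.
have /ub_le_sup : has_ubound (S f) by case: (dual_norm_has_sup f).
by apply; exists 0; rewrite /= ?normr0// linear0 normr0.
Qed.

Lemma ler_dual_norm f x : `|f x| <= dual_norm f * `|x|.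
Proof.
have [->|x0] := eqVneq x 0; first by rewrite linear0 !normr0 mulr0.
rewrite -ler_pdivrMr ?normr_gt0//.
have -> : `|f x| / `|x| = `|f (`|x|^-1 *: x)|.
  by rewrite linearZ normrZ ger0_norm ?invr_ge0// mulrC.
have /ub_le_sup : has_ubound (S f) by case: (dual_norm_has_sup f).
apply; exists (`|x|^-1 *: x) => //=.
by rewrite normrZ ger0_norm ?invr_ge0// mulVf ?normr_eq0.
Qed.

Lemma dual_norm_le f M : (forall x, `|x| <= 1 -> `|f x| <= M) ->
  dual_norm f <= M.
Proof.
move=> fM; apply: ge_sup; first by case: (dual_norm_has_sup f).
by move=> _ [x /= x1 <-]; exact: fM.
Qed.

Lemma ler_dual_norm1 f x : `|x| <= 1 -> `|f x| <= dual_norm f.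
Proof.
by move=> x1; apply: (le_trans (ler_dual_norm f x)); rewrite ler_piMr// dual_norm_ge0.
Qed.

Lemma dual_normD f g : dual_norm (f + g) <= dual_norm f + dual_norm g.
Proof.
apply: dual_norm_le => x x1.
by apply: (le_trans (ler_normD (f x) (g x))); rewrite lerD ?ler_dual_norm1.
Qed.

Lemma dual_normZ (l : R) f : dual_norm (l *: f) = `|l| * dual_norm f.
Proof.
have le m g : dual_norm (m *: g) <= `|m| * dual_norm g.
  apply: dual_norm_le => x x1; rewrite [X in `|X|](_ : _ = m *: g x)//.
  by rewrite normrZ ler_wpM2l// ler_dual_norm1.
apply/eqP; rewrite eq_le le/=.
have [->|l0] := eqVneq l 0; first by rewrite normr0 mul0r dual_norm_ge0.
rewrite -ler_pdivlMl ?normr_gt0// -normfV.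
by rewrite -[f in leLHS](scalerK l0) le.
Qed.

Lemma dual_norm0_eq0 f : dual_norm f = 0 -> f = 0.
Proof.
move=> f0; apply/val_inj/funext => x /=.
by apply/normr0_eq0/eqP; rewrite eq_le normr_ge0 andbT -(mul0r `|x|) -f0 ler_dual_norm.
Qed.

HB.instance Definition _ :=
  Lmodule_isNormed.Build R (dual V) dual_normD dual_normZ dual_norm0_eq0.

End DualNorm.

(* Surjectivity of the canonical embedding x |-> (f |-> f x) into the bidual. *)
Definition reflexive_space (R : realType) (V : normedModType R) : Prop :=
  forall g : dual (dual V), exists x : V, forall f : dual V, g f = f x.

Definition weak_cvg (R : realType) (V : normedModType R) (u : nat -> V) (l : V)
    : Prop :=
  forall f : dual V, f (u n) @[n --> \oo] --> f l.

Definition weak_cluster_point (R : realType) (V : normedModType R)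
    (u : nat -> V) (l : V) : Prop :=
  exists2 s : nat -> nat, increasing_seq s & weak_cvg (u \o s) l.

Definition weak_seq_continuous (R : realType) (V W : normedModType R)
    (G : V -> W) : Prop :=
  forall u l, weak_cvg u l -> weak_cvg (G \o u) (G l).

Definition weak_seq_lsc (R : realType) (V : normedModType R) (F : V -> R)
    : Prop :=
  forall u l, weak_cvg u l ->
    ((F l)%:E <= limn_einf (fun n => (F (u n))%:E))%E.

Definition coercive (R : realType) (V : normedModType R) (F : V -> R) : Prop :=
  forall M : R, exists r : R, forall x : V, r <= `|x| -> M <= F x.

Definition rel_subgradients (R : realType) (V : normedModType R)
    (psi F : V -> R) (x : V) : set (dual V) :=
  [set r | forall u, F x + r (u - x) <= F u + psi u].

Definition rel_subdifferentiable (R : realType) (V : normedModType R)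
    (psi F : V -> R) : Prop :=
  forall x, rel_subgradients psi F x !=set0.

Definition annihilator (R : realType) (V : normedModType R) (A : set V)
    : set (dual V) :=
  [set q | forall x0, A x0 -> q x0 = 0].

Definition tikhonov (R : realType) (X Y : normedModType R) (S : X -> Y -> R)
    (Reg : X -> R) (alpha : R) (y : Y) (x : X) : R :=
  S x y + alpha * Reg x.

(* The completeness of [X] and the metric [`|y - y'|] on [Y] required by (C1)
   come with the types. *)
Record regularization_conditions (R : realType)
    (X Y : completeNormedModType R) (p : R) (S : X -> Y -> R)
    (Reg phi : X -> R) : Prop := {
  condC1 : reflexive_space X ;
  condC2 : weak_seq_lsc Reg ;
  condC3 : rel_subdifferentiable phi Reg ;
  condC4_lsc : forall y, weak_seq_lsc (S ^~ y) ;
  condC4_convex : forall y,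
    convex_function [set: convex_lmodType X] (S ^~ y : X -> R^o) ;
  condC4_continuous : forall x, continuous (S x) ;
  condC5 : exists2 C : R, 0 < C & forall (z : X) (y y' : Y),
    S z y <= C * (S z y' + `|y - y'| `^ p) ;
  condC6 : forall (alpha : R) (y : Y), 0 < alpha ->
    coercive (tikhonov S Reg alpha y)
}.

Definition fidelity (R : realType) (X Y : normedModType R) (K : X -> Y) (p : R)
    (x : X) (y : Y) : R :=
  p^-1 * `|K x - y| `^ p.

(* Main.v *)
(* For x0 in ker K the fidelity S(., y_k) is constant along x0, so
   <S'(x_k, y_k), x0> = 0 and <R'(x_k), x0> = <z_k, x0> / alpha_k, which tends
   to 0. Weak continuity of R', tested with evaluation at x0 as an element of
   the bidual, identifies the limit along the subsequence as <R'(x_+), x0>. *)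
Require Import Defs.
From HB Require Import structures.
From mathcomp Require Import all_boot all_order all_algebra.
From mathcomp Require Import all_classical all_reals all_analysis.

Set Implicit Arguments.
Unset Strict Implicit.
Unset Printing Implicit Defensive.

Import Order.TTheory GRing.Theory Num.Theory.
Import numFieldTopology.Exports numFieldNormedType.Exports.

Local Open Scope classical_set_scope.
Local Open Scope ring_scope.

(** The value [df v] is the directional derivative of [f] at [x] along [v], and every difference
    quotient defining it vanishes. *)
Lemma is_diff_cst_line (R : realType) (V : normedModType R) (f : V -> R^o)
    (df : dual V) (x v : V) :
  is_diff x f df -> (forall h : R, f (h *: v + x) = f x) -> df v = 0.
Proof.
move=> fdf fv.
have <- : 'd f x v = df v by rewrite diff_val.
rewrite -deriveE; last by case: fdf.
rewrite /derive; apply/cvg_lim => //.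
rewrite (_ : (fun h : R => _) = cst 0); first exact: cvg_cst.
by apply/funext => h; rewrite /= fv subrr scaler0.
Qed.

(** Operations on [dual V] are pointwise, so evaluation is linear; it is bounded because
    [|f x| <= dual_norm f * |x|]. *)
Lemma dual_eval_subproof (R : realType) (V : normedModType R) (x : V) :
  (fun f : dual V => f x : R^o) \in dual_pred.
Proof.
have lin : linear (fun f : dual V => f x : R^o) by [].
apply/asboolP; split=> //.
pose evalL := GRing.isLinear.Build R (dual V) R^o _ _ lin.
pose ev : {linear dual V -> R^o} := HB.pack (fun f : dual V => f x : R^o) evalL.
apply: (bounded_linear_continuous (f := ev)).
(* Any [r >= |x|] serves as a bound for the evaluation at [x]. *)
apply/linear_boundedP; near=> r => f /=.
apply: le_trans (ler_dual_norm f x) _.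
rewrite mulrC ler_wpM2r ?dual_norm_ge0//.
Unshelve. all: by end_near. Qed.

Definition dual_eval (R : realType) (V : normedModType R) (x : V) :
  dual (dual V) := Dual (dual_eval_subproof x).

(** Weak convergence in the dual is tested against the whole bidual, which contains the evaluations;
    hence it implies weak-* convergence. *)
Lemma weak_cvg_dual (R : realType) (V : normedModType R) (u : nat -> dual V)
    (l : dual V) (x : V) : weak_cvg u l -> u n x @[n --> \oo] --> (l x : R).
Proof. by move=> /(_ (dual_eval x)). Qed.

(** A strictly increasing sequence of naturals satisfies [n <= s n], by induction. *)
Lemma increasing_seq_cvgny (s : nat -> nat) :
  increasing_seq s -> s n @[n --> \oo] --> \oo.
Proof.
move=> s_incr; apply/cvgnyPge => A; near=> n.
apply: (@leq_trans n); first by near: n; exact: nbhs_infty_ge.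
elim: (n) => // m /leq_ltn_trans; apply.
by have /increasing_seqP/(_ m) := s_incr.
Unshelve. all: by end_near. Qed.

Theorem lemma3p9 (R : realType) (X Y : completeNormedModType R)
  (K : {linear X -> Y}) (K_bounded : bounded_near K (nbhs (0 : X)))
  (p : R) (p_gt1 : 1 < p)
  (normp_diff : forall v : Y, differentiable (fun w : Y => `|w| `^ p : R^o) v)
  (Reg phi : X -> R)
  (Reg_ge0 : forall x, 0 <= Reg x) (phi_ge0 : forall x, 0 <= phi x)
  (conds : regularization_conditions p (fidelity K p) Reg phi)
  (dS : X -> Y -> dual X) (dReg : X -> dual X)
  (dS_diff : forall (x : X) (y : Y),
    is_diff x (fun x' : X => fidelity K p x' y : R^o) (dS x y))
  (dReg_diff : forall x : X, is_diff x (Reg : X -> R^o) (dReg x))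
  (dS_weak : forall y : Y, weak_seq_continuous (dS ^~ y))
  (dReg_weak : weak_seq_continuous dReg)
  (dReg_rel : forall x u : X, Reg x + dReg x (u - x) <= Reg u + phi u)
  (y : Y) (y_range : exists u : X, K u = y)
  (delta : nat -> R) (yk : nat -> Y)
  (yk_delta : forall k, `|yk k - y| <= delta k)
  (alpha : R -> R) (alpha_gt0 : forall k, 0 < alpha (delta k))
  (alpha_cvg0 : alpha (delta k) @[k --> \oo] --> (0 : R))
  (delta_alpha_cvg0 : delta k `^ p / alpha (delta k) @[k --> \oo] --> (0 : R))
  (xk : nat -> X) (zk : nat -> dual X)
  (zk_def : forall k, zk k = dS (xk k) (yk k) + alpha (delta k) *: dReg (xk k))
  (zk_cvg0 : `|zk k| / alpha (delta k) @[k --> \oo] --> (0 : R))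
  (zk_xk : forall k, zk k (xk k) <= 0)
  (xplus : X) (xplus_cluster : weak_cluster_point xk xplus) :
  annihilator (K @^-1` [set 0]) (- dReg xplus).
Proof.
move=> x0 /= Kx0.
have dS0 k : dS (xk k) (yk k) x0 = 0.
  apply: is_diff_cst_line (dS_diff _ _) _ => h.
  (* [K (h *: x0 + xk k) = K (xk k)], so the residual does not depend on [h]. *)
  by rewrite /fidelity linearP Kx0 scaler0 add0r.
have zk_ker k : zk k x0 / alpha (delta k) = dReg (xk k) x0.
  have -> : zk k x0 = dS (xk k) (yk k) x0 + alpha (delta k) * dReg (xk k) x0.
    by rewrite zk_def.
  by rewrite dS0 add0r mulrC mulKf// gt_eqF.
have dReg_cvg0 : dReg (xk k) x0 @[k --> \oo] --> (0 : R).
  apply/norm_cvg0P.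
  (* By [zk_ker], [|dReg (xk k) x0|] equals [|zk k x0| / alpha (delta k)], which the dual norm
     bounds by a fixed multiple, [|x0|], of a null sequence. *)
  apply: (@squeeze_cvgr _ _ _ _ (cst 0)
    (fun k => `|zk k| / alpha (delta k) * `|x0|)).
  - near=> k; rewrite normr_ge0 /= -zk_ker normrM mulrAC.
    rewrite [`|_^-1|]gtr0_norm ?invr_gt0// ler_wpM2r ?invr_ge0 ?(ltW (alpha_gt0 _))//.
    exact: ler_dual_norm.
  - exact: cvg_cst.
  - rewrite -[X in _ --> X](mul0r `|x0|); apply: cvgMl; exact: zk_cvg0.
case: xplus_cluster => s s_incr /dReg_weak s_weak.
have s_cvg := weak_cvg_dual (x := x0) s_weak.
(* The full sequence tends to 0, hence so does the subsequence; uniqueness of limits then gives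
   [dReg xplus x0 = 0]. *)
have s_cvg0 : dReg (xk (s n)) x0 @[n --> \oo] --> (0 : R).
  apply: (cvg_comp s (fun k => dReg (xk k) x0)) dReg_cvg0.
  exact: increasing_seq_cvgny.
rewrite -[(- _) x0]/(- dReg xplus x0).
by rewrite (cvg_unique _ s_cvg s_cvg0) ?oppr0.
Unshelve. all: by end_near. Qed.
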